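(* Let $C=\{(c_u,c_v,c_w)\in C_0^3 : c_w=c_u+c_v\}\subseteq \mathbb F^{3(n_0+1)}$, which is a $[3(n_0+1),2k_0]_{\mathbb F}$ code, and let $D=C^\perp$. Suppose there exist $2m$ dual codewords $$h^{(i)}=\bigl((h^{(i)}_{u,0},\dots,h^{(i)}_{u,n_0}),(h^{(i)}_{v,0},\dots,h^{(i)}_{v,n_0}),(h^{(i)}_{w,0},\dots,h^{(i)}_{w,n_0})\bigr)\in D,\qquad i=1,\dots,2m,$$ such that: (i) the matrix $$A=\begin{bmatrix} h_{u,0}^{(1)}+h_{w,0}^{(1)} & h_{v,0}^{(1)}+h_{w,0}^{(1)}\\ \vdots&\vdots\\ h_{u,0}^{(2m)}+h_{w,0}^{(2m)} & h_{v,0}^{(2m)}+h_{w,0}^{(2m)}\end{bmatrix}\in\mathbb F^{2m\times 2}$$ satisfies $\operatorname{rank}_{\mathbb B}(A^{\mathbb B})=2m$; and (ii) for every $x\in\{u,v,w\}$ and every $j\in\{1,\dots,n_0\}$, $\dim_{\mathbb B}\operatorname{span}_{\mathbb B}\{h^{(1)}_{x,j},\dots,h^{(2m)}_{x,j}\}=1$. Then there exists an equally distributed linear exact repair scheme for $C$ over $\mathbb B$.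
   Context: $\mathbb B=\mathbb F_q$ is a finite field and $\mathbb F$ is an extension field of $\mathbb B$ of degree $m$. An $[\ell,k]_{\mathbb F}$ code is a $k$-dimensional $\mathbb F$-linear subspace of $\mathbb F^{\ell}$; the dual $C^\perp$ is taken with respect to the standard bilinear form $\sum_i x_iy_i$. Base code: $C_0$ is an $[n_0+1,k_0]_{\mathbb F}$ code, with coordinates indexed by $0,\dots,n_0$, admitting a generator matrix (with $k_0$ linearly independent rows) of the form $G_0=\begin{bmatrix}-1&\phi\\0&\overline{G_0}\end{bmatrix}$, where $\phi\in\mathbb F^{n_0}$ is nonzero and $\overline{G_0}\in\mathbb F^{(k_0-1)\times n_0}$. In the associated Massey secret sharing scheme, the secret is the coordinate $c_0$ of a codeword $c\in C_0$ and the shares are $c_1,\dots,c_{n_0}$. Row expansion: fix a basis of $\mathbb F$ over $\mathbb B$. For $M\in\mathbb F^{a\times b}$, $M^{\mathbb B}\in\mathbb B^{a\times bm}$ is obtained by replacing each entry by the row vector of its $m$ coordinates in this basis. Equally distributed linear exact repair scheme (LERS) for $C$: $\mathbb B$-linear maps $g_{x,j}:\mathbb F\to\mathbb B$ for $x\in\{u,v,w\}$, $j\in\{1,\dots,n_0\}$ (one $\mathbb B$-symbol is queried from each share), together with a $\mathbb B$-linear reconstruction map $R:\mathbb B^{3n_0}\to\mathbb F^3$ such that for every $(c_u,c_v,c_w)\in C$, $R\bigl((g_{x,j}(c_{x,j}))_{x\in\{u,v,w\},\,1\le j\le n_0}\bigr)=(c_{u,0},c_{v,0},c_{w,0})$.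 *)

(* Defs.v *)
From HB Require Import structures.
From mathcomp Require Import all_boot all_order all_algebra all_field.

Set Implicit Arguments.
Unset Strict Implicit.
Unset Printing Implicit Defensive.

Import GRing.Theory.
Local Open Scope ring_scope.

Definition rows_seq (F : fieldType) (k l : nat) (G : 'M[F]_(k, l)) :
    seq 'rV[F]_l :=
  [seq row i G | i <- enum 'I_k].

Definition generator_matrix (F : fieldType) (k l : nat)
    (G : 'M[F]_(k, l)) (C : {vspace 'rV[F]_l}) : bool :=
  basis_of C (rows_seq G).

Definition dual_code (F : fieldType) (l : nat) (C : {vspace 'rV[F]_l})
    (y : 'rV[F]_l) : Prop :=
  forall x, x \in C -> \sum_i x 0 i * y 0 i = 0.

Definition lab_u : 'I_3 := @Ordinal 3 0 isT.
Definition lab_v : 'I_3 := @Ordinal 3 1 isT.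
Definition lab_w : 'I_3 := @Ordinal 3 2 isT.

(* A vector (c_u, c_v, c_w) of F^(3(n+1)) is the row-major flattening of the
   matrix with rows c_u, c_v, c_w. *)
Definition block (F : fieldType) (n : nat) (x : 'I_3)
    (c : 'rV[F]_(3 * n.+1)) : 'rV[F]_n.+1 :=
  row x (vec_mx c).

Definition entry (F : fieldType) (n : nat)
    (c : 'rV[F]_(3 * n.+1)) (x : 'I_3) (j : 'I_n.+1) : F :=
  block x c 0 j.

Fact block_is_linear (F : fieldType) (n : nat) (x : 'I_3) :
  linear (@block F n x).
Proof. by move=> a c d; rewrite /block !linearP. Qed.

HB.instance Definition _ (F : fieldType) (n : nat) (x : 'I_3) :=
  GRing.isLinear.Build F 'rV[F]_(3 * n.+1) 'rV[F]_n.+1 *:%R (@block F n x)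
    (@block_is_linear F n x).

Definition triple_code (F : fieldType) (n : nat) (C0 : {vspace 'rV[F]_n.+1}) :
    {vspace 'rV[F]_(3 * n.+1)} :=
  ((linfun (@block F n lab_u) @^-1: C0)
   :&: (linfun (@block F n lab_v) @^-1: C0)
   :&: (linfun (@block F n lab_w) @^-1: C0)
   :&: lker (linfun (@block F n lab_w)
               - (linfun (@block F n lab_u) + linfun (@block F n lab_v))%R)%R)%VS.

Lemma mem_triple_code (F : fieldType) (n : nat) (C0 : {vspace 'rV[F]_n.+1})
    (c : 'rV[F]_(3 * n.+1)) :
  (c \in triple_code C0) =
  [&& block lab_u c \in C0, block lab_v c \in C0, block lab_w c \in C0
    & block lab_w c == block lab_u c + block lab_v c].
Proof.
rewrite /triple_code !memv_cap -!memv_preim memv_ker.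
by rewrite add_lfunE opp_lfunE add_lfunE !lfunE /= -!andbA subr_eq0.
Qed.

(* Column mxvec_index j t, i.e. j * m + t, holds the coordinate of M i j along
   the t-th basis vector. *)
Definition row_expansion (B : fieldType) (F : fieldExtType B) (m : nat)
    (bs : m.-tuple F) (a b : nat) (M : 'M[F]_(a, b)) : 'M[B]_(a, b * m) :=
  \matrix_(i < a) mxvec (\matrix_(j < b, t < m) coord bs t (M i j)).

Definition secret_matrix (F : fieldType) (n r : nat)
    (h : 'I_r -> 'rV[F]_(3 * n.+1)) : 'M[F]_(r, 2) :=
  \matrix_(i < r, t < 2)
    (if t == ord0 then entry (h i) lab_u ord0 + entry (h i) lab_w ord0
     else entry (h i) lab_v ord0 + entry (h i) lab_w ord0).

(* Share j of a block is its coordinate lift ord0 j, coordinate 0 being the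
   secret. *)
Definition equally_distributed_LERS (B : fieldType) (F : fieldExtType B)
    (n : nat) (C : {vspace 'rV[F]_(3 * n.+1)})
    (g : 'I_3 -> 'I_n -> {linear F -> B^o})
    (R : {linear 'rV[B]_(3 * n) -> {ffun 'I_3 -> F}}) : Prop :=
  forall c, c \in C ->
    R (mxvec (\matrix_(x < 3, j < n) g x j (entry c x (lift ord0 j))))
    = [ffun x => entry c x ord0].

(* Main.v *)
(* Pairing a codeword c with h^(i) and substituting c_w0 = c_u0 + c_v0 gives
   A_i1 c_u0 + A_i2 c_v0 = - sum_(x, j) h^(i)_(x,j) c_(x,j).  By (ii), h^(i)_(x,j)
   is a B-multiple of some e_(x,j) independent of i, so for any nonzero B-linear
   functional tau on F the answers tau(e_(x,j) c_(x,j)) determine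
   tau(A_i1 c_u0 + A_i2 c_v0) for all i.  By (i), the rows of A span F^2 over B,
   so these values determine (c_u0, c_v0) by nondegeneracy of tau(x y). *)
Require Import Defs.
From HB Require Import structures.
From mathcomp Require Import all_boot all_order all_algebra all_field.

Set Implicit Arguments.
Unset Strict Implicit.
Unset Printing Implicit Defensive.

Import GRing.Theory.
Local Open Scope ring_scope.

Section TripleCodeDimension.
Variables (F : fieldType) (n : nat).
Implicit Types (a : 'rV[F]_3) (y z : 'rV[F]_n.+1).

Definition embed a y : 'rV[F]_(3 * n.+1) := mxvec (a^T *m y).

Fact embed_is_linear a : linear (embed a).
Proof. by move=> k y z; rewrite /embed !linearP. Qed.

HB.instance Definition _ a :=
  GRing.isLinear.Build F 'rV[F]_n.+1 'rV[F]_(3 * n.+1) *:%R (embed a)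
    (embed_is_linear a).

Lemma block_embed x a y : block x (embed a y) = a 0 x *: y.
Proof.
by apply/rowP=> j; rewrite /block /embed mxvecK !mxE big_ord1 !mxE.
Qed.

Lemma eq_block (c d : 'rV[F]_(3 * n.+1)) :
  (forall x, block x c = block x d) -> c = d.
Proof.
move=> eq_cd; rewrite -[c]vec_mxK -[d]vec_mxK; congr mxvec.
by apply/row_matrixP=> x; apply: eq_cd.
Qed.

(** The map [y |-> (y, 0, y)]; [emb_v] below is [z |-> (0, z, z)]. They split [(y, z, y + z)] into
    its two free parts. *)
Definition emb_u : 'Hom('rV[F]_n.+1, 'rV[F]_(3 * n.+1)) :=
  linfun (embed (\row_x (x != lab_v)%:R)).
Definition emb_v : 'Hom('rV[F]_n.+1, 'rV[F]_(3 * n.+1)) :=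
  linfun (embed (\row_x (x != lab_u)%:R)).

Lemma block_emb_u x y : block x (emb_u y) = (x != lab_v)%:R *: y.
Proof. by rewrite lfunE /= block_embed mxE. Qed.

Lemma block_emb_v x y : block x (emb_v y) = (x != lab_u)%:R *: y.
Proof. by rewrite lfunE /= block_embed mxE. Qed.

Lemma triple_code_sum (C0 : {vspace 'rV[F]_n.+1}) :
  triple_code C0 = (emb_u @: C0 + emb_v @: C0)%VS.
Proof.
apply/vspaceP=> c; rewrite mem_triple_code; apply/idP/idP.
  case/and4P=> cu cv _ /eqP cw.
  apply/memv_addP; exists (emb_u (block lab_u c)); first exact: memv_img.
  exists (emb_v (block lab_v c)); first exact: memv_img.
  apply: eq_block => x; rewrite linearD /= block_emb_u block_emb_v.
  case: x => [[|[|[|//]]] lt_x].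
  - rewrite scale1r scale0r addr0; congr block; exact: val_inj.
  - rewrite scale1r scale0r add0r; congr block; exact: val_inj.
  - rewrite !scale1r -cw; congr block; exact: val_inj.
case/memv_addP=> _ /memv_imgP[y Cy ->] [_ /memv_imgP[z Cz ->] ->].
rewrite !linearD /= !block_emb_u !block_emb_v /= !scale1r !scale0r.
by rewrite addr0 add0r Cy Cz memvD /=.
Qed.

(** Both embeddings are injective, and their images meet only in 0: block u recovers [y] from
    [emb_u y] but vanishes on the image of [emb_v]. *)
Lemma dim_triple_code (C0 : {vspace 'rV[F]_n.+1}) :
  \dim (triple_code C0) = (2 * \dim C0)%N.
Proof.
have inj_u : lker emb_u == 0%VS.
  apply/lker0P=> y z /(congr1 (block lab_u)).
  by rewrite !block_emb_u !scale1r.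
have inj_v : lker emb_v == 0%VS.
  apply/lker0P=> y z /(congr1 (block lab_v)).
  by rewrite !block_emb_v !scale1r.
rewrite triple_code_sum dimv_disjoint_sum.
  by rewrite !limg_dim_eq ?(eqP inj_u) ?(eqP inj_v) ?capv0 // mul2n addnn.
apply/eqP; rewrite -subv0; apply/subvP=> c; rewrite memv_cap memv0.
case/andP=> /memv_imgP[y _ ->] /memv_imgP[z _] /(congr1 (block lab_u)).
rewrite block_emb_u block_emb_v scale1r scale0r => ->.
by rewrite linear0.
Qed.

End TripleCodeDimension.

Lemma dual_code_entry (F : fieldType) (n : nat)
    (C : {vspace 'rV[F]_(3 * n.+1)}) (h c : 'rV[F]_(3 * n.+1)) :
  dual_code C h -> c \in C -> \sum_x \sum_j entry h x j * entry c x j = 0.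
Proof.
move=> Dh /Dh h_c; rewrite -[RHS]h_c pair_bigA /=.
rewrite (reindex _ (curry_mxvec_bij _ _)) /=.
by apply: eq_bigr => -[x j] _; rewrite /= /entry /block !mxE mulrC.
Qed.

Lemma triple_dual_sum (F : fieldType) (n : nat) (C0 : {vspace 'rV[F]_n.+1})
    (h c : 'rV[F]_(3 * n.+1)) :
  dual_code (triple_code C0) h -> c \in triple_code C0 ->
  (entry h lab_u ord0 + entry h lab_w ord0) * entry c lab_u ord0
  + (entry h lab_v ord0 + entry h lab_w ord0) * entry c lab_v ord0
  = - \sum_x \sum_(j < n) entry h x (lift ord0 j) * entry c x (lift ord0 j).
Proof.
move=> Dh Cc; apply/eqP; rewrite -addr_eq0; apply/eqP.
rewrite -[RHS](dual_code_entry Dh Cc).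
(* Coordinate 0 of each block, the secret, is separated from the shares. *)
under [RHS]eq_bigr do rewrite big_ord_recl.
rewrite big_split /=; congr (_ + _); rewrite !big_ord_recl big_ord0 addr0 /=.
have -> : ord0 = lab_u by apply: val_inj.
have -> : lift lab_u ord0 = lab_v by apply: val_inj.
have -> : lift lab_u (lift ord0 ord0) = lab_w by apply: val_inj.
move: Cc; rewrite mem_triple_code => /and4P[_ _ _ /eqP cw].
have -> : entry c lab_w ord0 = entry c lab_u ord0 + entry c lab_v ord0.
  by rewrite /entry cw mxE.
by rewrite !mulrDl mulrDr addrACA -addrA.
Qed.

Lemma dim1_span_scale (B : fieldType) (V : vectType B) (I : finType)
    (f : I -> V) :
  \dim <<[seq f i | i <- enum I]>>%VS = 1%N ->
  exists (e : V) (k : I -> B), forall i, f i = k i *: e.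
Proof.
set U := <<_>>%VS => dimU.
(* The span is nonzero, so its picked vector is nonzero and generates a line of the same dimension
   1. *)
have Ue : (<[vpick U]> == U)%VS.
  rewrite eqEdim -memvE memv_pick dimU dim_vline lt0b vpick0.
  by rewrite -dimv_eq0 dimU.
have /fin_all_exists[k def_f] : forall i, exists c : B, f i = c *: vpick U.
  move=> i; apply/vlineP; rewrite (eqP Ue).
  by apply: memv_span; apply: map_f; rewrite mem_enum.
by exists (vpick U), k.
Qed.

Section RowExpansion.
Variables (B : fieldType) (F : fieldExtType B) (m : nat) (bs : m.-tuple F).

(** Full column rank puts the expansion of [p] in the row space over [B]; the coefficients carry
    over to [F] because coordinates in a basis determine an element. *)
Lemma row_full_expansion_span (r b : nat) (A : 'M[F]_(r, b)) (p : 'rV[F]_b) :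
  basis_of {:F} bs -> row_full (row_expansion bs A) ->
  exists beta : 'I_r -> B, forall j, p 0 j = \sum_i beta i *: A i j.
Proof.
move=> bs_basis /(submx_full (row_expansion bs p))/submxP[be def_p].
exists (be 0) => j.
rewrite (coord_basis bs_basis (memvf (p 0 j))).
rewrite [RHS](coord_basis bs_basis (memvf _)).
apply: eq_bigr => t _; congr (_ *: _).
have /rowP/(_ (mxvec_index j t)) := def_p.
rewrite !mxE mxvecE mxE => ->; rewrite linear_sum; apply: eq_bigr => i _.
by rewrite linearZ /= !mxE mxvecE mxE.
Qed.

(** The form [tau(e * y)], with the coordinate [coord bs t] as the functional tau. For fixed [e] it
    is the query put to a share. *)
Definition coord_mul (t : 'I_m) (e y : F) : B^o := coord bs t (e * y).

Fact coord_mul_is_linear t e : linear (coord_mul t e).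
Proof. by move=> k y z; rewrite /coord_mul mulrDr -scalerAr linearP. Qed.

HB.instance Definition _ t e :=
  GRing.isLinear.Build B F B^o *:%R (coord_mul t e) (coord_mul_is_linear t e).

Lemma coord_mulD t (p q a b : F) :
  coord_mul t p a + coord_mul t q b = coord bs t (p * a + q * b).
Proof. by rewrite linearD. Qed.

(* Nondegeneracy of the B-bilinear form (e, y) |-> coord bs t (e * y); it plays
   the role of the trace form. *)
Lemma coord_mul_eq0 t y : free bs -> (forall e, coord_mul t e y = 0) -> y = 0.
Proof.
move=> free_bs y_perp; apply/eqP; apply: contraT => y0.
(* This choice of [e] makes [e * y] the basis vector of index [t], whose coordinate there is 1. *)
have := y_perp (bs`_t / y); rewrite /coord_mul divfK // coord_free // eqxx.
by move/eqP; rewrite oner_eq0.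
Qed.

(** The values of tau on the left-hand sides of the dual relations, as a [B]-linear function of the
    two free secrets, so that reconstruction amounts to inverting it. *)
Definition secret_queries r (A : 'M[F]_(r, 2)) (t : 'I_m) (s : F * F) :
    'rV[B]_r :=
  \row_i (coord_mul t (A i ord0) s.1 + coord_mul t (A i ord_max) s.2).

Fact secret_queries_is_linear r (A : 'M[F]_(r, 2)) t :
  linear (secret_queries A t).
Proof.
move=> k s s'; apply/rowP=> i; rewrite !mxE !linearP /=.
by rewrite mulrDr addrACA.
Qed.

HB.instance Definition _ r (A : 'M[F]_(r, 2)) t :=
  GRing.isLinear.Build B (F * F)%type 'rV[B]_r *:%R (secret_queries A t)
    (secret_queries_is_linear A t).

(* The functional (p, q) |-> coord bs t (p * a + q * b) vanishes on the rows of
   A, and these span F^2 over B. *)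
Lemma secret_queries_eq0 r (A : 'M[F]_(r, 2)) t s :
  basis_of {:F} bs -> row_full (row_expansion bs A) ->
  secret_queries A t s = 0 -> s = 0.
Proof.
case: s => a b bs_basis fullA /rowP s_perp.
have perp (p q : F) : coord_mul t p a + coord_mul t q b = 0.
  pose v : 'rV[F]_2 := \row_j (if j == ord0 then p else q).
  have [be def_v] := row_full_expansion_span v bs_basis fullA.
  have := def_v ord_max; have := def_v ord0; rewrite !mxE /= => -> ->.
  rewrite coord_mulD !mulr_suml -big_split linear_sum big1 //= => i _.
  have := s_perp i; rewrite !mxE /= coord_mulD => s_i.
  by rewrite -!scalerAl -scalerDr linearZ /= s_i mulr0.
have free_bs := basis_free bs_basis.
(* Setting [q = 0] isolates [a], and [p = 0] isolates [b]. *)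
congr (_, _); apply: (@coord_mul_eq0 t) => // e.
  by have := perp e 0; rewrite {2}/coord_mul mul0r linear0 addr0.
by have := perp 0 e; rewrite {1}/coord_mul mul0r linear0 add0r.
Qed.

Definition triple_secret (s : F * F) : {ffun 'I_3 -> F} :=
  [ffun x => if x == lab_u then s.1 else if x == lab_v then s.2 else s.1 + s.2].

Fact triple_secret_is_linear : linear triple_secret.
Proof.
move=> k s s'; apply/ffunP=> x; rewrite !ffunE /=.
by case: ifP => // _; case: ifP => // _; rewrite scalerDr addrACA.
Qed.

HB.instance Definition _ :=
  GRing.isLinear.Build B (F * F)%type {ffun 'I_3 -> F} *:%R triple_secret
    triple_secret_is_linear.

End RowExpansion.

Lemma LERS_of_dual_codewords (B : fieldType) (F : fieldExtType B) (m : nat)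
    (bs : m.-tuple F) (n r : nat) (C0 : {vspace 'rV[F]_n.+1})
    (h : 'I_r -> 'rV[F]_(3 * n.+1)) :
  basis_of {:F} bs ->
  (forall i, dual_code (triple_code C0) (h i)) ->
  row_full (row_expansion bs (secret_matrix h)) ->
  (forall (x : 'I_3) (j : 'I_n),
     \dim (<<[seq entry (h i) x (lift ord0 j) | i <- enum 'I_r]>>%VS
            : {vspace F}) = 1%N) ->
  exists (g : 'I_3 -> 'I_n -> {linear F -> B^o})
         (R : {linear 'rV[B]_(3 * n) -> {ffun 'I_3 -> F}}),
    equally_distributed_LERS (triple_code C0) g R.
Proof.
move=> bs_basis Dh fullA dim1.
have m_gt0 : (0 < m)%N by rewrite -(size_basis bs_basis) adim_gt0.
pose t0 := Ordinal m_gt0.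
have /fin_all_exists[e /fin_all_exists[k def_h]] :
    forall xj : 'I_3 * 'I_n, exists (e : F) (k : 'I_r -> B),
      forall i, entry (h i) xj.1 (lift ord0 xj.2) = k i *: e.
  by case=> x j; apply: dim1_span_scale (dim1 x j).
pose L := linfun (secret_queries bs (secret_matrix h) t0).
(* Column [i] combines the answers with the scalars of the [i]-th dual codeword; the sign is that of
   the right-hand side in [triple_dual_sum]. *)
pose K : 'M[B]_(3 * n, r) :=
  \matrix_(l, i) - mxvec (\matrix_(x, j) k (x, j) i) 0 l.
have L_inj : lker L == 0%VS.
  rewrite -subv0; apply/subvP=> s; rewrite memv_ker memv0 lfunE => /eqP s0.
  by apply/eqP; apply: secret_queries_eq0 s0.
exists (fun x j => coord_mul bs t0 (e (x, j)) : {linear F -> B^o}).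
(* Only a left inverse of [L] is needed, since the combined answers [q] lie in the image of [L]. *)
exists (@triple_secret B F \o (L^-1%VF \o mulmxr K)) => c Cc /=.
set q := _ *m K.
pose s := (entry c lab_u ord0, entry c lab_v ord0).
have -> : q = L s.
  apply/rowP=> i; rewrite lfunE !mxE /= coord_mulD.
  rewrite (triple_dual_sum (Dh i) Cc) linearN /= pair_bigA /= linear_sum /=.
  (* Flat share indices become pairs [(x, j)], and the two sums are compared term by term. *)
  rewrite (reindex _ (curry_mxvec_bij _ _)) /= -sumrN.
  apply: eq_bigr => -[x j] _ /=; rewrite [K _ _]mxE !mxvecE !mxE mulrN.
  by rewrite (def_h (x, j) i) /= -scalerAl linearZ /= mulrC.
rewrite lker0_lfunK //; apply/ffunP=> x; rewrite !ffunE /=.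
case: eqP => [-> // | x_u]; case: eqP => [-> // | x_v].
have -> : x = lab_w.
  by apply: val_inj; case: x x_u x_v => [[|[|[|//]]] lt_x] //= u v;
    [case: u | case: v]; apply: val_inj.
move: Cc; rewrite mem_triple_code => /and4P[_ _ _ /eqP cw].
by rewrite [in RHS]/entry cw [RHS]mxE.
Qed.

Theorem theorem3 (B : finFieldType) (F : fieldExtType B) (m : nat)
  (degF : \dim {:F} = m)
  (bs : m.-tuple F) (bs_basis : basis_of {:F} bs)
  (n0 k0 : nat) (C0 : {vspace 'rV[F]_n0.+1}) (k0_gt0 : (0 < k0)%N)
  (dimC0 : \dim C0 = k0)
  (phi : 'rV[F]_n0) (phi_neq0 : phi != 0) (G0bar : 'M[F]_(k0.-1, n0))
  (genC0 : generator_matrix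
     (block_mx (-1)%:M phi 0 G0bar : 'M[F]_(1 + k0.-1, 1 + n0)) C0) :
  \dim (triple_code C0) = (2 * k0)%N /\
  ((exists h : 'I_(2 * m) -> 'rV[F]_(3 * n0.+1),
      [/\ forall i, dual_code (triple_code C0) (h i),
          \rank (row_expansion bs (secret_matrix h)) = (2 * m)%N
        & forall (x : 'I_3) (j : 'I_n0),
            \dim (<<[seq entry (h i) x (lift ord0 j)
                    | i <- enum 'I_(2 * m)]>>%VS : {vspace F}) = 1%N]) ->
   exists (g : 'I_3 -> 'I_n0 -> {linear F -> B^o})
          (R : {linear 'rV[B]_(3 * n0) -> {ffun 'I_3 -> F}}),
     equally_distributed_LERS (triple_code C0) g R).
Proof.
split; first by rewrite dim_triple_code dimC0.
case=> h [Dh rank_h dim1]; apply: LERS_of_dual_codewords bs_basis Dh _ dim1.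
(* The expansion of a matrix with two columns has [2 * m] columns, so this rank is full column
   rank. *)
by rewrite /row_full rank_h.
Qed.
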